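(* Let $X\subset\mathbb{R}^d$ be a bounded convex domain, let $(I_\delta)_{\delta>0}$, $I_\delta:\mathcal{C}(X)\to E_\delta$, be a family of linear interpolation operators with common constant $C_I\ge 1$, and for each $\varepsilon>0$ let $M_\varepsilon$ be the set of discretized convexity constraints on $X$ (built from an arbitrary choice of admissible $U_\varepsilon\subseteq\partial X$). Let $f:\mathbb{R}_+\to\mathbb{R}_+$ be a function such that $$\lim_{\delta\to 0} f(\delta)=0,\qquad \lim_{\delta\to 0}\frac{\delta}{f(\delta)^2}=0.$$ Let $\mathcal{H}$ be the set of continuous convex functions on $X$ and, for $\gamma>0$, let $\mathrm{B}_{\mathrm{Lip}}^\gamma$ be the set of $\gamma$-Lipschitz functions on $X$. Then, for every $\gamma>0$, $$\mathcal{H}\cap \mathrm{B}_{\mathrm{Lip}}^{\gamma/C_I}\ \subseteq\ \overline{\lim}_{\delta\to 0}\left[\mathcal{H}_{M_{f(\delta)}}\cap E_\delta\cap \mathrm{B}_{\mathrm{Lip}}^\gamma\right]\ \subseteq\ \mathcal{H}\cap \mathrm{B}_{\mathrm{Lip}}^\gamma .$$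
   Context: $X\subset\mathbb{R}^d$ is a bounded convex domain, understood to contain its boundary $\partial X$. $\mathcal{C}(X)$ is the space of bounded continuous functions on $X$ with the uniform norm $\|\cdot\|_\infty$; $\mathrm{Lip}(g)$ is the Lipschitz constant of $g$. For a set $L$ of affine forms on $\mathcal{C}(X)$, $\mathcal{H}_L:=\{g\in\mathcal{C}(X):\ \forall \ell\in L,\ \ell(g)\le 0\}$. Discretized convexity constraints. For $x\neq y$ in $X$ and $z\in[x,y]$, set $\ell_{xyz}(g):=g(z)-\frac{\|z-y\|}{\|x-y\|}g(x)-\frac{\|x-z\|}{\|x-y\|}g(y)$. For $\varepsilon>0$, let $U_\varepsilon\subseteq\partial X$ be such that every $x\in\partial X$ admits $x_\varepsilon\in U_\varepsilon$ with $\|x-x_\varepsilon\|\le\varepsilon$. For distinct $p,q\in U_\varepsilon$ let $c_{pq}:=\{p+\varepsilon i\frac{q-p}{\|q-p\|}:\ i\in\mathbb{N},\ 0\le i\le\|q-p\|/\varepsilon\}$. Then $M_\varepsilon:=\{\ell_{xyz}:\ x,y,z\in c_{pq}\text{ for some distinct }p,q\in U_\varepsilon,\ x\ne y,\ z\in[x,y]\}$. Interpolation operator. A (linear) interpolation operator is a continuous linear map $I_\delta$ from $\mathcal{C}(X)$ to a finite-dimensional linear subspace $E_\delta\subseteq\mathcal{C}(X)$ whose restriction to $E_\delta$ is the identity; it is assumed that $E_\delta$ contains the affine functions on $X$ and that: (L1) $\mathrm{Lip}(I_\delta g)\le C_I\,\mathrm{Lip}(g)$; (L2) $\|g-I_\delta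 g\|_\infty\le\delta\,\mathrm{Lip}(g)$; (L3) $\|g-I_\delta g\|_\infty\le\frac12\delta^2\,\mathrm{Lip}(\nabla g)$ (for those $g$ for which the right-hand side is defined and finite). The constant $C_I\ge 1$ is the same for the whole family. Superior limit (in the paper's sense): for a family $(A_\delta)_{\delta>0}$ of subsets of $\mathcal{C}(X)$, $\overline{\lim}_{\delta\to0}A_\delta$ is the set of $g\in\mathcal{C}(X)$ for which there exist $g_\delta\in A_\delta$ with $g_\delta\to g$ uniformly as $\delta\to 0$. *)

(* Defs.v *)
From HB Require Import structures.
From mathcomp Require Import all_boot all_order all_algebra.
From mathcomp Require Import all_classical all_reals all_analysis.

Set Implicit Arguments.
Unset Strict Implicit.
Unset Printing Implicit Defensive.

Import Order.TTheory GRing.Theory Num.Theory.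
Import numFieldNormedType.Exports.

Local Open Scope classical_set_scope.
Local Open Scope ring_scope.

(* The norm `|x| that the library puts on 'rV[R]_d is the sup norm; it induces
   the usual topology, but all metric quantities below use the Euclidean norm. *)
Definition enorm (R : realType) (d : nat) (x : 'rV[R]_d) : R :=
  Num.sqrt (\sum_i x ord0 i ^+ 2).

Definition segment_between (R : realType) (d : nat) (x y : 'rV[R]_d) :
    set 'rV[R]_d :=
  [set (1 - t) *: x + t *: y | t in `[0, 1]].

Definition boundary (R : realType) (d : nat) (X : set 'rV[R]_d) :
  set 'rV[R]_d := closure X `\` X°.

Definition bounded_convex_domain (R : realType) (d : nat)
    (X : set 'rV[R]_d) : Prop :=
  [/\ bounded_set X, convex_set X, closed X & X° !=set0].

(* The space of bounded continuous real functions on a topological space,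
   normed by the uniform norm. *)
Section bounded_continuous.
Variables (R : realType) (T : topologicalType).

Definition bctsP : {pred T -> R^o} :=
  fun g => `[< continuous g /\ bounded_fun g >].

Lemma bcts_boundP (g : T -> R^o) :
  bounded_fun g <-> exists M : R, forall x, `|g x| <= M.
Proof.
split=> [[M0 [_ H]]|[M H]].
- by exists (M0 + 1) => x; apply: (H (M0 + 1)) => //; rewrite ltrDl.
- exists M; split; first exact: num_real.
  by move=> N MN x _; apply: le_trans (H x) (ltW MN).
Qed.

Lemma bcts_submod_closed : submod_closed bctsP.
Proof.
split.
  apply/asboolP; split; first by move=> x; exact: cvg_cst.
  by apply/bcts_boundP; exists 0 => x; rewrite normr0.
move=> a u v /asboolP[cu /bcts_boundP[Mu bu]] /asboolP[cv /bcts_boundP[Mv bv]].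
apply/asboolP; split.
  move=> x; apply: (@cvgD _ _ _ _ _ (a *: u) v); last exact: cv.
  by apply: cvgZr; exact: cu.
apply/bcts_boundP; exists (`|a| * Mu + Mv) => x.
apply: le_trans (ler_normD _ _) _; apply: lerD (bv x).
by rewrite normrZ ler_wpM2l.
Qed.

HB.instance Definition _ :=
  GRing.isSubmodClosed.Build R (T -> R^o) bctsP bcts_submod_closed.

Record bcts := Bcts { bcts_val : T -> R^o ; _ : bcts_val \in bctsP }.

HB.instance Definition _ := [isSub for bcts_val].
HB.instance Definition _ := [Choice of bcts by <:].
HB.instance Definition _ := [SubChoice_isSubZmodule of bcts by <:].
HB.instance Definition _ := [SubZmodule_isSubLmodule of bcts by <:].

Definition sup_norm (g : bcts) : R := sup [set `|bcts_val g x| | x in setT].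

Lemma sup_norm_ub (g : bcts) x : `|bcts_val g x| <= sup_norm g.
Proof.
have /asboolP[_ /bcts_boundP[M bM]] := valP g.
by apply: ub_le_sup; [exists M => _ [y _ <-]; exact: bM | exists x].
Qed.

Lemma sup_norm_ge0 (g : bcts) : 0 <= sup_norm g.
Proof.
rewrite /sup_norm; set A := [set _ | _ in _].
have [[y [x _ _]]|/nonemptyPn ->] := pselect (A !=set0); last by rewrite sup0.
exact: le_trans (normr_ge0 _) (sup_norm_ub g x).
Qed.

Lemma sup_norm_le (g : bcts) (M : R) : 0 <= M ->
  (forall x, `|bcts_val g x| <= M) -> sup_norm g <= M.
Proof.
move=> M0 bM; rewrite /sup_norm; set A := [set _ | _ in _].
have [A0|/nonemptyPn ->] := pselect (A !=set0); last by rewrite sup0.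
by apply: ge_sup => // _ [x _ <-]; exact: bM.
Qed.

Lemma sup_normD (g h : bcts) : sup_norm (g + h) <= sup_norm g + sup_norm h.
Proof.
apply: sup_norm_le => [|x]; first by rewrite addr_ge0 ?sup_norm_ge0.
apply: le_trans (ler_normD (bcts_val g x) (bcts_val h x)) _.
by apply: lerD; exact: sup_norm_ub.
Qed.

Lemma sup_normZ_le (a : R) (g : bcts) : sup_norm (a *: g) <= `|a| * sup_norm g.
Proof.
apply: sup_norm_le => [|x]; first by rewrite mulr_ge0 ?sup_norm_ge0.
have -> : bcts_val (a *: g) x = a * bcts_val g x by [].
by rewrite normrM ler_wpM2l ?sup_norm_ub.
Qed.

Lemma sup_normZ (a : R) (g : bcts) : sup_norm (a *: g) = `|a| * sup_norm g.
Proof.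
apply/eqP; rewrite eq_le sup_normZ_le/=.
have [->|a0] := eqVneq a 0; first by rewrite normr0 mul0r sup_norm_ge0.
have := sup_normZ_le a^-1 (a *: g).
by rewrite scalerA mulVf// scale1r normfV ler_pdivlMl ?normr_gt0.
Qed.

Lemma sup_norm0_eq0 (g : bcts) : sup_norm g = 0 -> g = 0.
Proof.
move=> g0; apply/val_inj/funext => x /=.
by apply/eqP; rewrite -normr_le0 -g0; exact: sup_norm_ub.
Qed.

HB.instance Definition _ :=
  Lmodule_isNormed.Build R bcts sup_normD sup_normZ sup_norm0_eq0.

End bounded_continuous.

Section definitions.
Variables (R : realType) (d : nat) (X : set 'rV[R]_d).
Local Notation V := 'rV[R]_d.
Local Notation CX := (bcts R (set_type X)).
Implicit Types (g : CX) (x y z p q : V) (C_I delta eps gamma : R).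

(* A function on X is evaluated at points of R^d through its extension by 0;
   the statements below only use its values at points of X (and its
   derivatives at interior points of X). *)
Definition ext g : V -> R^o := valL_ (0 : R^o) (bcts_val g).

(* N is the norm of the codomain *)
Definition is_lipschitz_on (W : zmodType) (N : W -> R) (D : set V) (F : V -> W)
    (k : R) : Prop :=
  0 <= k /\
  forall x y, D x -> D y -> N (F x - F y) <= k * enorm (x - y).

(* Lipschitz constant, +oo if there is none *)
Definition Lip_on (W : zmodType) (N : W -> R) (D : set V) (F : V -> W) :
    \bar R :=
  ereal_inf [set k%:E | k in is_lipschitz_on N D F].

Definition Lip g : \bar R := Lip_on (@Num.norm R R) X (ext g).

Definition B_Lip gamma : set CX :=
  [set g | is_lipschitz_on (@Num.norm R R) X (ext g) gamma].

Definition gradient (F : V -> R^o) x : V := \row_i 'D_(delta_mx ord0 i) F x.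

Definition Lip_gradient g : \bar R :=
  Lip_on (@enorm R d) X° (gradient (ext g)).

Definition convex_continuous : set CX :=
  [set g | convex_function X (ext g)].

Definition constrained (L : set (CX -> R)) : set CX :=
  [set g | forall l, L l -> l g <= 0].

Definition ell x y z g : R :=
  ext g z - enorm (z - y) / enorm (x - y) * ext g x
          - enorm (x - z) / enorm (x - y) * ext g y.

Definition boundary_net eps (U : set V) : Prop :=
  U `<=` boundary X /\
  forall x, boundary X x -> exists2 u, U u & enorm (x - u) <= eps.

Definition chord_points eps p q : set V :=
  [set p + (eps * i%:R / enorm (q - p)) *: (q - p) |
     i in [set i : nat | i%:R <= enorm (q - p) / eps]].

Definition discretized_convexity eps (U : set V) : set (CX -> R) :=
  [set l | exists p q x y z,
     [/\ [/\ U p, U q & p != q],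
         [/\ chord_points eps p q x, chord_points eps p q y
           & chord_points eps p q z],
         x != y,
         segment_between x y z
       & l = ell x y z]].

Definition finite_dim_subspace (E : set CX) : Prop :=
  exists (n : nat) (b : 'I_n -> CX),
    E = [set \sum_i a i *: b i | a in [set: 'I_n -> R]].

Definition is_affine_on g : Prop :=
  exists (a : V) (c : R),
    forall x, X x -> ext g x = \sum_i a ord0 i * x ord0 i + c.

(* Lip and Lip_gradient are +oo when no constant exists, so that (for
   delta > 0) the last three fields only constrain I on functions for which the
   right-hand side is finite. *)
Record interpolation_operator C_I delta (E : set CX)
    (I : {linear CX -> CX}) : Prop := InterpolationOperator {
  interp_finite_dim : finite_dim_subspace E ;
  interp_continuous : continuous I ;
  interp_range : forall g, E (I g) ;
  interp_id : forall g, E g -> I g = g ;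
  interp_affine : forall g, is_affine_on g -> E g ;
  interp_L1 : forall g, (Lip (I g) <= C_I%:E * Lip g)%E ;
  interp_L2 : forall g, (`|g - I g|%:E <= delta%:E * Lip g)%E ;
  interp_L3 : forall g, (forall x, X° x -> differentiable (ext g) x) ->
    (`|g - I g|%:E <= (delta ^+ 2 / 2)%:E * Lip_gradient g)%E
}.

Definition superior_limit (A : R -> set CX) : set CX :=
  [set g | exists g_ : R -> CX,
     (forall delta, 0 < delta -> A delta (g_ delta)) /\
     g_ delta @[delta --> 0^'+] --> g].

End definitions.

(* Main.v *)
(* Left inclusion: if g is convex and (gamma / C_I)-Lipschitz, perturb it to
   h = (1 - t) g + s |x|^2 with s of order delta / f(delta)^2 and t proportional
   to s, so that h has the same Lipschitz constant as g.  Distinct points of a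
   discretized chord are at distance at least f(delta), hence
   ell_xyz(|x|^2) = - |x - z| |z - y| <= - f(delta)^2, which absorbs the error
   2 |h - I h| <= 2 delta Lip(h) made by replacing h with its interpolant.

   Right inclusion: extend the segment [x, y] to a chord [a, b] of X, replace a
   and b by points p and q of U, and round the parameters of x, z, y down to the
   grid.  Rounding is monotone and moves points by O(f(delta)), so the discrete
   constraint on these grid points passes to the limit. *)
Require Import Defs.
From mathcomp Require Import all_boot all_order all_algebra.
From mathcomp Require Import all_classical all_reals all_analysis.
From mathcomp Require Import ring lra.
Set Implicit Arguments.
Unset Strict Implicit.
Unset Printing Implicit Defensive.

Import Order.TTheory GRing.Theory Num.Theory.
Import numFieldNormedType.Exports.
Local Open Scope classical_set_scope.
Local Open Scope ring_scope.

(** * The Euclidean norm: Cauchy-Schwarz, triangle inequality, comparison with the sup norm *)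

Section euclidean_norm.
Context {R : realType} {d : nat}.
Implicit Types (x y : 'rV[R]_d) (a : R).

Lemma enorm_ge0 x : 0 <= enorm x.
Proof. exact: sqrtr_ge0. Qed.

Lemma sqr_enorm x : enorm x ^+ 2 = \sum_i x ord0 i ^+ 2.
Proof. by rewrite sqr_sqrtr// sumr_ge0// => i _; exact: sqr_ge0. Qed.

Lemma enormZ a x : enorm (a *: x) = `|a| * enorm x.
Proof.
rewrite /enorm -sqrtr_sqr -sqrtrM ?sqr_ge0// mulr_sumr; congr Num.sqrt.
by apply: eq_bigr => i _; rewrite mxE exprMn.
Qed.

Lemma enormN x : enorm (- x) = enorm x.
Proof. by rewrite -scaleN1r enormZ normrN normr1 mul1r. Qed.

Lemma enorm_eq0 x : (enorm x == 0) = (x == 0).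
Proof.
apply/eqP/eqP => [x0|->]; last by rewrite -(scale0r 0) enormZ normr0 mul0r.
have /eqP := sqr_enorm x; rewrite x0 expr0n/= eq_sym psumr_eq0; last first.
  by move=> i _; exact: sqr_ge0.
move=> /allP h; apply/rowP => i; rewrite mxE.
by apply/eqP; rewrite -sqrf_eq0; apply: h; rewrite mem_index_enum.
Qed.

Lemma enorm_gt0 x : (0 < enorm x) = (x != 0).
Proof. by rewrite lt_def enorm_ge0 andbT enorm_eq0. Qed.

(** Cauchy-Schwarz. After a sign change of [x], expand the sum of squares of
    [enorm y * x_i - enorm x * y_i]: it is nonnegative and equals [2 * enorm x * enorm y] times
    [enorm x * enorm y - s], where [s] is the inner product. *)
Lemma sum_mul_le_enorm x y :
  `|\sum_i x ord0 i * y ord0 i| <= enorm x * enorm y.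
Proof.
wlog s0 : x / 0 <= \sum_i x ord0 i * y ord0 i => [wl|].
  have [|/ltW s0] := leP 0 (\sum_i x ord0 i * y ord0 i); first exact: wl.
  have sN : \sum_i (- x) ord0 i * y ord0 i = - \sum_i x ord0 i * y ord0 i.
    by rewrite -sumrN; apply: eq_bigr => i _; rewrite mxE mulNr.
  by rewrite -normrN -sN -[enorm x]enormN; apply: wl; rewrite sN oppr_ge0.
rewrite ger0_norm//.
have [->|x0] := eqVneq x 0.
  by rewrite big1 ?mulr_ge0 ?enorm_ge0// => i _; rewrite mxE mul0r.
have [->|y0] := eqVneq y 0.
  by rewrite big1 ?mulr_ge0 ?enorm_ge0// => i _; rewrite mxE mulr0.
have x_gt0 : 0 < enorm x by rewrite enorm_gt0.
have y_gt0 : 0 < enorm y by rewrite enorm_gt0.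
have sqE a b : \sum_i (b * x ord0 i - a * y ord0 i) ^+ 2 =
    b ^+ 2 * enorm x ^+ 2 - (2 * a * b) * \sum_i x ord0 i * y ord0 i
    + a ^+ 2 * enorm y ^+ 2.
  rewrite !sqr_enorm !mulr_sumr -sumrB -big_split/=.
  by apply: eq_bigr => i _; ring.
have : 0 <= \sum_i (enorm y * x ord0 i - enorm x * y ord0 i) ^+ 2.
  by rewrite sumr_ge0// => i _; exact: sqr_ge0.
rewrite sqE; set s := \sum_i _.
have -> : enorm y ^+ 2 * enorm x ^+ 2 - (2 * enorm x * enorm y) * s
    + enorm x ^+ 2 * enorm y ^+ 2 =
    (enorm x * enorm y) * (2 * (enorm x * enorm y - s)) by ring.
by rewrite pmulr_rge0 ?mulr_gt0// pmulr_rge0// subr_ge0.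
Qed.

Lemma enormD x y : enorm (x + y) <= enorm x + enorm y.
Proof.
rewrite -(@ler_pXn2r _ 2) ?nnegrE ?addr_ge0 ?enorm_ge0// sqrrD.
rewrite !sqr_enorm.
have -> : \sum_i (x + y) ord0 i ^+ 2 = \sum_i x ord0 i ^+ 2
   + (\sum_i x ord0 i * y ord0 i) *+ 2 + \sum_i y ord0 i ^+ 2.
  rewrite -sumrMnl -!big_split/=; apply: eq_bigr => i _.
  by rewrite mxE sqrrD.
rewrite lerD2r lerD2l lerMn2r/=.
exact: le_trans (ler_norm _) (sum_mul_le_enorm x y).
Qed.

Lemma norm_coord_le x (i : 'I_d) : `|x ord0 i| <= `|x|.
Proof.
rewrite /Num.Def.normr/= mx_normrE.
exact: (@le_bigmax _ _ _ 0 (fun k : 'I_1 * 'I_d => `|x k.1 k.2|) (ord0, i)).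
Qed.

(** Serves to turn [bounded_set], which refers to the sup norm, into a Euclidean bound. The crude
    factor [d] comes from bounding the sum of [d] squares by [d ^ 2] times the largest. *)
Lemma enorm_le_norm x : enorm x <= d%:R * `|x|.
Proof.
have h : \sum_i x ord0 i ^+ 2 <= (d%:R * `|x|) ^+ 2.
  apply: (@le_trans _ _ (\sum_(i < d) `|x| ^+ 2)).
    apply: ler_sum => i _; rewrite -(real_normK (num_real (x ord0 i))).
    rewrite ler_pXn2r ?nnegrE//.
    exact: norm_coord_le.
  rewrite sumr_const card_ord -[_ ^+ 2 *+ d]mulr_natl exprMn.
  apply: ler_wpM2r; first exact: sqr_ge0.
  by rewrite -natrX ler_nat; case: (d) => // n; rewrite leq_pmulr.
by rewrite -(@ler_pXn2r _ 2) ?nnegrE ?mulr_ge0 ?enorm_ge0// sqr_enorm.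
Qed.

End euclidean_norm.

(** * Functions on X: evaluation, Lipschitz bounds, the squared norm; rays in X *)

Section extension.
Context {R : realType} {d : nat} {X : set 'rV[R]_d}.
Local Notation CX := (bcts R (set_type X)).
Implicit Types (g h : CX) (x y z : 'rV[R]_d).

Lemma ext_val g (u : set_type X) : ext g (val u) = bcts_val g u.
Proof. exact: (congr1 (fun F => F (bcts_val g) u) (sigL_valL (0 : R^o))). Qed.

Lemma extP x : X x -> exists u : set_type X, x = val u.
Proof. by move=> /mem_set Xx; exists (SigSub Xx). Qed.

Lemma ext0 x : ext (0 : CX) x = 0.
Proof. by rewrite /ext /valL_/=; case: ('oinv_set_val x). Qed.

Lemma extD g h x : X x -> ext (g + h) x = ext g x + ext h x.
Proof. by move=> /extP[u ->]; rewrite !ext_val. Qed.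

Lemma extB g h x : X x -> ext (g - h) x = ext g x - ext h x.
Proof. by move=> /extP[u ->]; rewrite !ext_val. Qed.

Lemma extZ (a : R) g x : X x -> ext (a *: g) x = a * ext g x.
Proof. by move=> /extP[u ->]; rewrite !ext_val. Qed.

Lemma ext_le_norm g x : X x -> `|ext g x| <= `|g|.
Proof. by move=> /extP[u ->]; rewrite ext_val; exact: sup_norm_ub. Qed.

Lemma dist_ext_le g h x : X x -> `|ext g x - ext h x| <= `|g - h|.
Proof. by move=> Xx; rewrite -extB//; exact: ext_le_norm. Qed.

Lemma bounded_enorm : bounded_set X ->
  exists2 D : R, 0 < D & forall x, X x -> enorm x <= D.
Proof.
move=> [M [_ bM]]; exists (d%:R * (`|M| + 1) + 1).
  by rewrite ltr_wpDl// mulr_ge0// addr_ge0.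
move=> x Xx; apply: (le_trans (enorm_le_norm x)).
rewrite ler_wpDr// ler_wpM2l//; apply: (bM (`|M| + 1)) => //.
by rewrite (le_lt_trans (ler_norm M))// ltrDl.
Qed.

(** Makes the strictly convex perturbation an element of C(X); boundedness of [X] is what bounds
    it. *)
Lemma squared_enorm_bcts : bounded_set X ->
  exists q : CX, forall x, X x -> ext q x = enorm x ^+ 2.
Proof.
move=> /bounded_enorm[D D0 bD].
pose q : set_type X -> R^o := fun u => enorm (val u) ^+ 2.
have qP : q \in @bctsP R (set_type X).
  apply/asboolP; split; last first.
    apply/bcts_boundP; exists (D ^+ 2) => u.
    rewrite ger0_norm ?sqr_ge0// ler_pXn2r ?nnegrE ?enorm_ge0 ?(ltW D0)//.
    by apply: bD; exact: set_valP.
  have -> : q = \sum_i (fun u : set_type X => (val u) ord0 i ^+ 2 : R^o).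
    by apply/funext => u; rewrite /q sqr_enorm fct_sumE.
  apply: (big_ind (fun F : set_type X -> R^o => continuous F)).
  - exact: (@cst_continuous (set_type X) R^o 0).
  - by move=> F G cF cG u; exact: (cvgD (cF u) (cG u)).
  - move=> i _ u.
    have vc : {for u, continuous (fun u : set_type X => (val u) ord0 i)}.
      apply: (@continuous_comp (set_type X) 'rV[R]_d R set_val (fun x => x ord0 i)).
        exact: initial_continuous.
      exact: coord_continuous.
    exact: (cvgM vc vc).
exists (Bcts qP) => x /extP[u ->]; exact: ext_val.
Qed.

(** For distinct points the difference quotient is a lower bound of all Lipschitz constants, hence
    at most their infimum [Lip g]. *)
Lemma Lip_le_lipschitz g (k : R) : (Lip g <= k%:E)%E -> B_Lip (X := X) k g.
Proof.
move=> gk; split.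
  rewrite -lee_fin; apply: le_trans gk; apply: le_ereal_inf_tmp => _ [l [l0 _] <-].
  by rewrite lee_fin.
move=> x y Xx Xy.
have [->|xy] := eqVneq x y.
  by rewrite !subrr normr0 (eqP (_ : enorm _ == 0)) ?enorm_eq0// mulr0.
have e0 : 0 < enorm (x - y) by rewrite enorm_gt0 subr_eq0.
rewrite -ler_pdivrMr// -lee_fin; apply: le_trans gk.
apply: le_ereal_inf_tmp => _ [l [_ hl] <-].
by rewrite lee_fin ler_pdivrMr//; exact: hl.
Qed.

Lemma lipschitz_Lip_le g (k : R) : B_Lip (X := X) k g -> (Lip g <= k%:E)%E.
Proof. by move=> gk; apply: ge_ereal_inf; exists k%:E => //; exists k. Qed.

(** Cauchy-Schwarz applied to the factorization of [|x|^2 - |y|^2] as the inner product of [x + y]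
    and [x - y]. *)
Lemma lipschitz_squared_enorm (q : CX) (D : R) :
  (forall x, X x -> ext q x = enorm x ^+ 2) ->
  0 <= D -> (forall x, X x -> enorm x <= D) -> B_Lip (X := X) (2 * D) q.
Proof.
move=> qE D0 bD; split=> [|x y Xx Xy]; first by rewrite mulr_ge0.
rewrite !qE// !sqr_enorm -sumrB.
have -> : \sum_i (x ord0 i ^+ 2 - y ord0 i ^+ 2) =
    \sum_i (x + y) ord0 i * (x - y) ord0 i.
  by apply: eq_bigr => i _; rewrite !mxE; ring.
apply: (le_trans (sum_mul_le_enorm _ _)); rewrite ler_wpM2r ?enorm_ge0//.
by rewrite (le_trans (enormD _ _))// mulr2n mulrDl !mul1r lerD ?bD.
Qed.

Lemma lipschitzD g h (k l : R) : B_Lip (X := X) k g -> B_Lip (X := X) l h ->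
  B_Lip (X := X) (k + l) (g + h).
Proof.
move=> [k0 gk] [l0 hl]; split=> [|x y Xx Xy]; first exact: addr_ge0.
by rewrite !extD// opprD addrACA mulrDl (le_trans (ler_normD _ _))// lerD ?gk ?hl.
Qed.

Lemma lipschitzZ g (a k : R) : B_Lip (X := X) k g ->
  B_Lip (X := X) (`|a| * k) (a *: g).
Proof.
move=> [k0 gk]; split=> [|x y Xx Xy]; first exact: mulr_ge0.
by rewrite !extZ// -mulrBr normrM -mulrA ler_wpM2l ?gk.
Qed.

Lemma convex_setP : convex_set X -> forall (x y : 'rV[R]_d) (t : R),
  0 <= t <= 1 -> X x -> X y -> X (x + t *: (y - x)).
Proof.
move=> cX x y t t01 /mem_set Xx /mem_set Xy.
have /set_mem := cX y x (Itv01 (andP t01).1 (andP t01).2) Xy Xx.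
rewrite /conv/=; congr X; apply/rowP => i.
by rewrite !mxE/= /unstable.onem; ring.
Qed.

(** Take the supremum of the parameters whose point lies in [X]. Closedness keeps that point in [X];
    were it interior, a slightly larger parameter would still be admissible. *)
Lemma ray_boundary x (v : 'rV[R]_d) : closed X -> bounded_set X -> X x ->
  v != 0 -> exists2 s : R, 0 <= s & boundary X (x + s *: v).
Proof.
move=> clX /bounded_enorm[D D0 bD] Xx v0.
have v_gt0 : 0 < enorm v by rewrite enorm_gt0.
pose line (s : R) : 'rV[R]_d := x + s *: v.
have line_cont : continuous line.
  move=> s; apply: cvgD; first exact: cvg_cst.
  by apply: cvgZr_tmp.
pose S := line @^-1` X.
have S0 : S 0 by rewrite /S/= /line scale0r addr0.
have ubS : has_ubound S.
  exists (2 * D / enorm v) => s Ss; rewrite ler_pdivlMr//.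
  apply: (@le_trans _ _ (enorm (s *: v))).
    by rewrite enormZ ler_wpM2r ?enorm_ge0// ler_norm.
  have -> : s *: v = line s - x by rewrite /line addrC addKr.
  rewrite (le_trans (enormD _ _))// enormN mulr2n mulrDl !mul1r.
  by rewrite lerD ?bD.
have XS : X (line (sup S)).
  apply: (preimage_closed _ clX); last exact: (closure_sup (ex_intro _ 0 S0) ubS).
  by move=> s _; exact: line_cont.
exists (sup S); first exact: ub_le_sup.
split; first exact: subset_closure.
move=> /(line_cont (sup S)) /nbhs_ballP[e /= e0 he].
have : S (sup S + e / 2).
  apply: he; rewrite /ball/= opprD addNKr normrN gtr0_norm ?divr_gt0//.
  by rewrite gtr_pMr// invf_lt1// ltr1n.
by move=> /(ub_le_sup ubS); rewrite gerDl leNgt divr_gt0.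
Qed.

End extension.

(** * Geometry of the discretized chords: spacing, rounding, distance to a nearby chord *)

Section chords.
Context {R : realType} {d : nat}.
Implicit Types (a b p q x y z : 'rV[R]_d) (eps : R).

(** The distance is [eps * |i - j|] for the grid indices [i] and [j], and distinct integers differ
    by at least 1. *)
Lemma chord_points_spacing eps p q x y : 0 < eps -> p != q ->
  chord_points eps p q x -> chord_points eps p q y -> x != y ->
  eps <= enorm (x - y).
Proof.
move=> e0 pq [i _ <-] [j _ <-] xy.
have L0 : 0 < enorm (q - p) by rewrite enorm_gt0 subr_eq0 eq_sym.
have ij : i != j by apply: contraNneq xy => ->.
rewrite opprD addrACA subrr add0r -scalerBl enormZ -!mulrBl -mulrBr.
rewrite !normrM normfV (gtr0_norm L0) divfK ?gt_eqF// gtr0_norm//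
  ler_peMr ?(ltW e0)//.
have -> : (i%:R - j%:R : R) = (i%:Z - j%:Z)%:~R by rewrite intrB.
rewrite -intr_norm ler1z -gtz0_ge1 normr_gt0 subr_eq0.
by apply: contra ij => /eqP[->].
Qed.

Lemma chord_points_sub (X : set 'rV[R]_d) eps p q : convex_set X -> 0 < eps ->
  p != q -> X p -> X q -> chord_points eps p q `<=` X.
Proof.
move=> cX e0 pq Xp Xq _ [i /= ile <-].
have L0 : 0 < enorm (q - p) by rewrite enorm_gt0 subr_eq0 eq_sym.
apply: (convex_setP cX _ Xp Xq); rewrite divr_ge0 ?mulr_ge0 ?(ltW e0) ?(ltW L0)//=.
by rewrite ler_pdivrMr// mul1r mulrC -ler_pdivlMr.
Qed.

(** [r] rounds the arc length down to a multiple of [eps]. Being a floor, it is monotone, so ordered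
    parameters stay ordered, and for [u <= 1] the index does not overrun the chord. *)
Lemma chord_points_round eps p q : 0 < eps -> p != q -> exists r : R -> R,
  {homo r : u v / u <= v} /\
  forall u, 0 <= u <= 1 -> [/\ `|r u - u| <= eps / enorm (q - p) &
                             chord_points eps p q (p + r u *: (q - p))].
Proof.
move=> e0 pq; set L := enorm (q - p).
have L0 : 0 < L by rewrite enorm_gt0 subr_eq0 eq_sym.
exists (fun u => eps * (Num.trunc (u * (L / eps)))%:R / L); split=> [u v uv|u].
  rewrite ler_pM2r ?invr_gt0// ler_pM2l// ler_nat le_truncn// ler_pM2r//.
  exact: divr_gt0.
move=> /andP[u0 u1].
have w0 : 0 <= u * (L / eps) by rewrite mulr_ge0// divr_ge0 ?ltW.
have /andP[lo hi] := truncn_itv w0.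
split; last first.
  exists (Num.trunc (u * (L / eps))) => //=.
  by rewrite (le_trans lo)// ler_piMl// divr_ge0 ?ltW.
have -> : eps * (Num.trunc (u * (L / eps)))%:R / L - u =
    - (eps / L * (u * (L / eps) - (Num.trunc (u * (L / eps)))%:R)).
  by field; rewrite !gt_eqF.
rewrite normrN normrM gtr0_norm ?divr_gt0// ler_piMr ?divr_ge0 ?(ltW e0) ?(ltW L0)//.
rewrite ger0_norm ?subr_ge0// lerBlDr -natr1 addrC in hi *.
by rewrite ltW.
Qed.

(** One [eps] bounds the convex combination of the endpoint errors [a - p] and [b - q], the other
    the drift [(r - u) *: (q - p)] along the chord. *)
Lemma chord_dist eps a b p q (u r : R) : 0 <= u <= 1 ->
  p != q -> enorm (a - p) <= eps -> enorm (b - q) <= eps ->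
  `|r - u| <= eps / enorm (q - p) ->
  enorm ((a + u *: (b - a)) - (p + r *: (q - p))) <= 2 * eps.
Proof.
move=> /andP[u0 u1] pq ap bq ru.
have L0 : 0 < enorm (q - p) by rewrite enorm_gt0 subr_eq0 eq_sym.
have -> : (a + u *: (b - a)) - (p + r *: (q - p)) =
    (1 - u) *: (a - p) + u *: (b - q) - (r - u) *: (q - p).
  by apply/rowP => i; rewrite !mxE; ring.
have h1 := enormD ((1 - u) *: (a - p) + u *: (b - q)) (- ((r - u) *: (q - p))).
have h2 := enormD ((1 - u) *: (a - p)) (u *: (b - q)).
rewrite enormN in h1; rewrite !enormZ in h1 h2.
rewrite (ger0_norm u0) ger0_norm ?subr_ge0// in h2.
rewrite ler_pdivlMr// in ru.
have h3 : (1 - u) * enorm (a - p) <= (1 - u) * eps by rewrite ler_wpM2l ?subr_ge0.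
have h4 : u * enorm (b - q) <= u * eps by rewrite ler_wpM2l.
lra.
Qed.

End chords.

(** * Discrete constraints: barycentric form, and robustness under a strictly convex perturbation *)

Section constraints.
Context {R : realType} {d : nat} {X : set 'rV[R]_d}.
Local Notation CX := (bcts R (set_type X)).
Implicit Types (g h : CX) (x y z p q : 'rV[R]_d) (eps : R) (U : set 'rV[R]_d).

Lemma ell_segment g x y (t : R) : x != y -> 0 <= t <= 1 ->
  let z := (1 - t) *: x + t *: y in
  [/\ enorm (x - z) = t * enorm (x - y), enorm (z - y) = (1 - t) * enorm (x - y)
    & ell x y z g = ext g z - (1 - t) * ext g x - t * ext g y].
Proof.
move=> xy /andP[t0 t1] z.
have E0 : enorm (x - y) != 0 by rewrite enorm_eq0 subr_eq0.
have xz : enorm (x - z) = t * enorm (x - y).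
  rewrite -[t in RHS]ger0_norm// -enormZ; congr enorm.
  by apply/rowP => i; rewrite !mxE; ring.
have zy : enorm (z - y) = (1 - t) * enorm (x - y).
  rewrite -[1 - t in RHS]ger0_norm ?subr_ge0// -enormZ; congr enorm.
  by apply/rowP => i; rewrite !mxE; ring.
by split => //; rewrite /ell xz zy !mulfK.
Qed.

(* Without denominators, so that r = s needs no separate treatment. *)
Lemma constrained_chord eps U g p q (r t s : R) :
  constrained (discretized_convexity (X := X) eps U) g ->
  U p -> U q -> p != q ->
  let c (u : R) := p + u *: (q - p) in
  chord_points eps p q (c r) -> chord_points eps p q (c t) ->
  chord_points eps p q (c s) -> r <= t <= s ->
  (s - r) * ext g (c t) <= (s - t) * ext g (c r) + (t - r) * ext g (c s).
Proof.
move=> Hg Up Uq pq c cr ct cs /andP[rt ts].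
have [rs|rs] := eqVneq r s.
  have -> : t = r by apply/eqP; rewrite eq_le rt rs ts.
  by rewrite -rs !subrr !mul0r addr0.
have sr0 : 0 < s - r by rewrite subr_gt0 lt_neqAle rs (le_trans rt ts).
have crs : c r != c s.
  rewrite -subr_eq0 opprD addrACA subrr add0r -scalerBl scaler_eq0 negb_or.
  by rewrite !subr_eq0 rs eq_sym.
(* Barycentric coordinate of [c t] between [c r] and [c s]; the claim is the constraint [ell <= 0]
   multiplied by [s - r]. *)
pose w := (t - r) / (s - r).
have w01 : 0 <= w <= 1.
  by rewrite divr_ge0 ?subr_ge0 ?(le_trans rt)// ler_pdivrMr// mul1r lerD2r.
have stE : s - t = (s - r) * (1 - w) by rewrite /w; field; exact: lt0r_neq0.
have trE : t - r = (s - r) * w by rewrite /w; field; exact: lt0r_neq0.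
have ctE : c t = (1 - w) *: c r + w *: c s.
  apply/rowP => i; rewrite !mxE /w; field; exact: lt0r_neq0.
rewrite stE trE; clearbody w => {stE trE}.
have [_ _ ellE] := ell_segment g crs w01.
have : ell (c r) (c s) (c t) g <= 0.
  apply: Hg; exists p, q, (c r), (c s), (c t); split => //.
  by exists w; rewrite /= ?in_itv.
rewrite ctE {}ellE -ctE => h.
by rewrite -!mulrA -mulrDr ler_pM2l//; lra.
Qed.

(** At a nondegenerate triple, [ell] is at most 0 on [g] and at most [- eps ^+ 2] on [q]. Passing to
    [h] costs [e] at [z] and [(1 - t) * e + t * e] at [x] and [y], in total [2 * e]. *)
Lemma constrained_perturbation eps U g (q h : CX) (l s e : R) :
  convex_set X -> U `<=` X -> 0 < eps -> convex_continuous g ->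
  (forall x, X x -> ext q x = enorm x ^+ 2) -> 0 <= l -> 0 <= s ->
  `|l *: g + s *: q - h| <= e -> 2 * e <= s * eps ^+ 2 ->
  constrained (discretized_convexity (X := X) eps U) h.
Proof.
move=> cX UX e0 cg qE l0 s0 he es c [a [b [x [y [z]]]]].
move=> [[Ua Ub ab] [cx cy cz] xy [t /= t01 zE] ->] {c}.
rewrite in_itv/= in t01.
have := ell_segment h xy t01; rewrite zE => -[xz zy ->].
have sub := chord_points_sub cX e0 ab (UX _ Ua) (UX _ Ub).
have [Xx Xy Xz] := And3 (sub _ cx) (sub _ cy) (sub _ cz).
(* If [z] is an endpoint, the spacing gives no gap between [z] and that endpoint, but [ell] vanishes
   identically. *)
have [zx|zx] := eqVneq z x.
  have /eqP := xz; rewrite zx subrr eq_sym (eqP (_ : enorm 0 == 0)) ?enorm_eq0//.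
  rewrite mulf_eq0 enorm_eq0 subr_eq0 (negbTE xy) orbF => /eqP t00; rewrite t00; lra.
have [zy'|zy'] := eqVneq z y.
  have /eqP := zy; rewrite zy' subrr eq_sym (eqP (_ : enorm 0 == 0)) ?enorm_eq0//.
  rewrite mulf_eq0 enorm_eq0 !subr_eq0 (negbTE xy) orbF => /eqP t1; rewrite -t1; lra.
(* Away from x and y, the strict convexity of q beats the error e. *)
have qell : ext q z - (1 - t) * ext q x - t * ext q y =
    - (enorm (x - z) * enorm (z - y)).
  rewrite xz zy mulrACA -expr2 !qE// !sqr_enorm !mulr_sumr -!sumrB -sumrN.
  by apply: eq_bigr => i _; rewrite -zE !mxE; ring.
have gell : ext g z <= (1 - t) * ext g x + t * ext g y.
  have := cg (Itv01 (andP t01).1 (andP t01).2) y x (mem_set Xy) (mem_set Xx).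
  rewrite /conv/= /unstable.onem [_ *: y + _]addrC zE.
  by rewrite [X in _ <= X -> _]addrC.
have gap : eps ^+ 2 <= enorm (x - z) * enorm (z - y).
  rewrite expr2 ler_pM ?(ltW e0)//.
    by apply: chord_points_spacing cx cz _; rewrite // eq_sym.
  exact: chord_points_spacing cz cy zy'.
have close u : X u -> `|l * ext g u + s * ext q u - ext h u| <= e.
  move=> Xu; rewrite (le_trans _ he)// -!extZ// -extD//; exact: dist_ext_le.
have := close _ Xz; have := close _ Xx; have := close _ Xy.
(* These sides bound [h] from below at [x] and [y] and from above at [z], as an upper bound on [ell]
   requires. *)
rewrite !ler_norml => /andP[_ y2] /andP[_ x2] /andP[z1 _].
have /andP[t0 t1] := t01.
have x3 := ler_wpM2l (_ : 0 <= 1 - t) x2.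
have y3 := ler_wpM2l t0 y2.
have g3 := ler_wpM2l l0 gell.
have q3 := ler_wpM2l s0 gap.
have qs : s * ext q z = s * ((1 - t) * ext q x + t * ext q y
   - enorm (x - z) * enorm (z - y)) by congr (_ * _); lra.
rewrite subr_ge0 in x3; have {}x3 := x3 t1.
move: x3 y3 g3 q3 qs z1 es.
rewrite !(mulrBr, mulrDr).
nra.
Qed.

End constraints.

(** * Passing from rounded chord points to convexity along a true chord *)

Section limits.
Context {R : realType} {d : nat} {X : set 'rV[R]_d}.
Local Notation CX := (bcts R (set_type X)).
Implicit Types (g h : CX) (x y z a b : 'rV[R]_d) (eps : R) (U : set 'rV[R]_d).

(** [F] samples [g] at the rounded points of the chord joining net points [p] and [q] near [a] and
    [b]. The discrete inequality is exact for [r] and [F], which differ from the parameters and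
    values on [a, b] by errors of order [eps]. *)
Lemma constrained_chord_approx eps U g (gamma : R) a b :
  closed X -> convex_set X -> 0 < eps -> boundary_net X eps U ->
  constrained (discretized_convexity (X := X) eps U) g ->
  B_Lip (X := X) gamma g -> boundary X a -> boundary X b ->
  4 * eps <= enorm (b - a) -> exists r F : R -> R,
    (forall u, 0 <= u <= 1 ->
       `|r u - u| * enorm (b - a) <= 2 * eps /\
       `|F u - ext g (a + u *: (b - a))| <= gamma * (2 * eps)) /\
    (forall u t v, 0 <= u -> u <= t -> t <= v -> v <= 1 ->
       (r v - r u) * F t <= (r v - r t) * F u + (r t - r u) * F v).
Proof.
move=> clX cX e0 [UX net] cg [gamma0 Lg] ba bb ab.
have bX : boundary X `<=` X by move=> x [/clX].
have [p Up ap] := net _ ba; have [q Uq bq] := net _ bb.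
have Xp := bX _ (UX _ Up); have Xq := bX _ (UX _ Uq).
(* Together with [4 * eps <= enorm (b - a)] this gives both [p != q] and
   [enorm (b - a) <= 2 * enorm (q - p)], the source of the factor 2 in the parameter error. *)
have ab_pq : enorm (b - a) <= enorm (q - p) + 2 * eps.
  have -> : b - a = (q - p) + ((b - q) - (a - p)).
    by apply/rowP => i; rewrite !mxE; ring.
  have := enormD (q - p) ((b - q) - (a - p)).
  have := enormD (b - q) (- (a - p)); rewrite enormN.
  lra.
have pq : p != q.
  apply/eqP => pq; move: ab_pq; rewrite pq subrr.
  rewrite (eqP (_ : enorm 0 == 0)) ?enorm_eq0//; lra.
have L0 : 0 < enorm (q - p) by rewrite enorm_gt0 subr_eq0 eq_sym.
have [r [r_homo rP]] := chord_points_round e0 pq.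
exists r, (fun u => ext g (p + r u *: (q - p))); split => [u u01|u t v u0 ut tv v1].
  have [ru cu] := rP _ u01; split.
    apply: (@le_trans _ _ (`|r u - u| * (2 * enorm (q - p)))).
      by rewrite ler_wpM2l//; lra.
    by rewrite mulrCA ler_wpM2l// -ler_pdivlMr.
  rewrite distrC (le_trans (Lg _ _ _ _))//.
  - exact: (convex_setP cX u01 (bX _ ba) (bX _ bb)).
  - exact: (chord_points_sub cX e0 pq Xp Xq cu).
  - by rewrite ler_wpM2l// chord_dist.
have chord w : 0 <= w <= 1 -> chord_points eps p q (p + r w *: (q - p)).
  by move=> /rP[].
apply: (constrained_chord cg Up Uq pq); rewrite ?r_homo//; apply: chord.
- by rewrite u0 (le_trans ut)// (le_trans tv).
- by rewrite (le_trans u0)// (le_trans tv).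
- by rewrite v1 (le_trans u0)// (le_trans ut).
Qed.

Lemma three_chord_limit (G : R -> R) (B : R) (u t v : R) :
  0 <= u -> u <= t -> t <= v -> v <= 1 ->
  (forall w, 0 <= w <= 1 -> `|G w| <= B) ->
  (forall e, 0 < e <= 1 -> exists r F : R -> R,
    (forall w, 0 <= w <= 1 -> `|r w - w| <= e /\ `|F w - G w| <= e) /\
    (r v - r u) * F t <= (r v - r t) * F u + (r t - r u) * F v) ->
  (v - u) * G t <= (v - t) * G u + (t - u) * G v.
Proof.
move=> u0 ut tv v1 GB approx.
have u01 : 0 <= u <= 1 by apply/andP; split; lra.
have t01 : 0 <= t <= 1 by apply/andP; split; lra.
have v01 : 0 <= v <= 1 by apply/andP; split; lra.
have B0 : 0 <= B := le_trans (normr_ge0 _) (GB _ u01).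
(* Three products occur in the inequality, and [term] bounds the error of each by
   [e * (3 + 2 * B)]. *)
pose K := 3 * (3 + 2 * B).
have K0 : 0 < K by rewrite /K; lra.
suff small e : 0 < e <= 1 -> (v - u) * G t <= (v - t) * G u + (t - u) * G v + K * e.
  apply/ler_addgt0Pr => e e0.
  have e1 : 0 < Num.min 1 (e / K) <= 1.
    by rewrite lt_min ltr01 divr_gt0//= ge_min lexx.
  apply: (le_trans (small _ e1)); rewrite lerD2l mulrC -ler_pdivlMr//.
  by rewrite ge_min lexx orbT.
move=> e01; have [r [F [rF rFle]]] := approx _ e01.
have /andP[e0 e1] := e01.
(* The error in the value contributes at most [1 * e], the errors of the two parameters at most
   [2 * e * (1 + B)]; [e <= 1] is used to bound [F] by [1 + B]. *)
have term (x y w : R) : 0 <= x <= 1 -> 0 <= y <= 1 -> 0 <= w <= 1 ->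
    `|(x - y) * G w - (r x - r y) * F w| <= e * (3 + 2 * B).
  move=> x01 y01 w01.
  have [rx _] := rF _ x01; have [ry _] := rF _ y01; have [_ Fw] := rF _ w01.
  have -> : (x - y) * G w - (r x - r y) * F w =
      - ((x - y) * (F w - G w) + (r x - x - (r y - y)) * F w) by ring.
  have xy : `|x - y| <= 1 by rewrite ler_norml; apply/andP; split; lra.
  have FB : `|F w| <= 1 + B.
    rewrite -[F w](subrK (G w)) (le_trans (ler_normD _ _))//.
    by rewrite lerD ?GB// (le_trans Fw).
  have h1 := ler_pM (normr_ge0 _) (normr_ge0 _) xy Fw.
  have rxy : `|r x - x - (r y - y)| <= 2 * e.
    by rewrite (le_trans (ler_normB _ _))//; lra.
  have h2 := ler_pM (normr_ge0 _) (normr_ge0 _) rxy FB.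
  by rewrite normrN (le_trans (ler_normD _ _))// !normrM; lra.
have := term v u t v01 u01 t01; have := term v t u v01 t01 u01.
have := term t u v t01 u01 v01.
rewrite !ler_norml => /andP[h1 _] /andP[h2 _] /andP[_ h3].
rewrite /K; lra.
Qed.

End limits.

(** * Right inclusion: limits of constrained Lipschitz functions *)

Section superior_limit_constrained.
Context {R : realType} {d : nat} {X : set 'rV[R]_d}.
Local Notation CX := (bcts R (set_type X)).
Variables (U : R -> set 'rV[R]_d) (f : R -> R) (gamma : R).
Hypothesis hX : bounded_convex_domain X.
Hypothesis hU : forall eps : R, 0 < eps -> boundary_net X eps (U eps).
Hypothesis f_gt0 : forall delta : R, 0 < delta -> 0 < f delta.
Hypothesis f_cvg0 : f delta @[delta --> 0^'+] --> (0 : R).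

Lemma lipschitz_cvg (g_ : R -> CX) (g : CX) :
  (forall delta, 0 < delta -> B_Lip (X := X) gamma (g_ delta)) ->
  g_ delta @[delta --> 0^'+] --> g -> B_Lip (X := X) gamma g.
Proof.
move=> Lg_ gg; split; first by have [] := Lg_ 1 ltr01.
move=> x y Xx Xy; apply/ler_addgt0Pr => e e0.
have [delta [d0 gd]] : exists delta, 0 < delta /\ `|g - g_ delta| <= e / 2.
  near (0 : R)^'+ => delta; exists delta.
  split; first by near: delta; exact: nbhs_right_gt.
  near: delta; apply: cvgr_dist_le => //; exact: divr_gt0.
have := (Lg_ _ d0).2 x y Xx Xy.
have := le_trans (dist_ext_le g (g_ delta) Xx) gd.
have := le_trans (dist_ext_le g (g_ delta) Xy) gd.
rewrite !ler_norml; lra.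
Unshelve. all: by end_near. Qed.

Lemma convex_cvg (g_ : R -> CX) (g : CX) :
  (forall delta, 0 < delta ->
     constrained (discretized_convexity (X := X) (f delta) (U (f delta)))
       (g_ delta)) ->
  (forall delta, 0 < delta -> B_Lip (X := X) gamma (g_ delta)) ->
  g_ delta @[delta --> 0^'+] --> g -> convex_continuous g.
Proof.
have [bX cX clX _] := hX.
move=> cg Lg gg k y x /set_mem Xy /set_mem Xx.
have [->|xy] := eqVneq x y; first by rewrite !convmm.
have gamma0 : 0 <= gamma by have [] := Lg 1 ltr01.
have yx0 : y - x != 0 by rewrite subr_eq0 eq_sym.
have xy0 : x - y != 0 by rewrite subr_eq0.
have [s1 s10 ba] := ray_boundary clX bX Xx xy0.
have [s2 s20 bb] := ray_boundary clX bX Xy yx0.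
set a := x + s1 *: (x - y) in ba; set b := y + s2 *: (y - x) in bb.
(* [T] is the length of [a, b] in units of [y - x]. On this chord [x], the intermediate point and
   [y] have parameters [s1 / T], [(s1 + kk) / T] and [(1 + s1) / T]. *)
pose T := 1 + s1 + s2; have T0 : 0 < T by rewrite /T; lra.
have baE : b - a = T *: (y - x).
  by apply/rowP => i; rewrite !mxE /T; ring.
have ba0 : 0 < enorm (b - a).
  by rewrite enorm_gt0 baE scaler_eq0 negb_or gt_eqF.
have cE w : a + (w / T) *: (b - a) = x + (w - s1) *: (y - x).
  rewrite baE scalerA divfK ?gt_eqF//.
  by apply/rowP => i; rewrite !mxE; ring.
have /andP[k0 k1] : 0 <= k%:num <= 1 by rewrite ge0 le1.
set kk := k%:num in k0 k1.
pose G w := ext g (a + w *: (b - a)).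
have Xa : X a by case: ba => /clX.
have Xb : X b by case: bb => /clX.
have Xc w : 0 <= w <= 1 -> X (a + w *: (b - a)).
  by move=> w01; exact: convex_setP.
have main : ((1 + s1) / T - s1 / T) * G ((s1 + kk) / T) <=
    ((1 + s1) / T - (s1 + kk) / T) * G (s1 / T) +
    ((s1 + kk) / T - s1 / T) * G ((1 + s1) / T).
  apply: (@three_chord_limit _ G `|g|).
  - by rewrite divr_ge0// ltW.
  - by rewrite ler_pM2r ?invr_gt0//; lra.
  - by rewrite ler_pM2r ?invr_gt0//; lra.
  - by rewrite ler_pdivrMr// /T; lra.
  - by move=> w w01; exact/ext_le_norm/Xc.
  move=> e /andP[e0 e1].
  (* The bounds on [f delta] serve in turn to apply [constrained_chord_approx], to make the
     parameter error at most [e], and to make the value error at most [e / 2], the other half coming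
     from [g - g_ delta]. The [gamma + 1] keeps the denominator positive when [gamma] is 0. *)
  have [delta [d0 gd fba fe fg]] : exists delta, [/\ 0 < delta,
      `|g - g_ delta| <= e / 2, f delta <= enorm (b - a) / 4,
      f delta <= e * enorm (b - a) / 2 & f delta <= e / (4 * (gamma + 1))].
    have fsmall c : 0 < c -> \forall delta \near 0^'+, f delta <= c.
      move=> c0; near=> delta; apply: (le_trans (ler_norm _)).
      by rewrite -normrN -sub0r; near: delta; exact: cvgr_dist_le.
    near (0 : R)^'+ => delta; exists delta; split.
    - by near: delta; exact: nbhs_right_gt.
    - by near: delta; apply: cvgr_dist_le => //; exact: divr_gt0.
    - by near: delta; apply: fsmall; exact: divr_gt0.
    - by near: delta; apply: fsmall; rewrite divr_gt0// mulr_gt0.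
    - by near: delta; apply: fsmall; rewrite divr_gt0// mulr_gt0//; lra.
  have fd0 := f_gt0 d0.
  have fba4 : 4 * f delta <= enorm (b - a) by lra.
  have [r [F [rF Fle]]] := constrained_chord_approx
    clX cX fd0 (hU fd0) (cg _ d0) (Lg _ d0) ba bb fba4.
  exists r, F; split => [w w01|].
    have [rw Fw] := rF _ w01; split.
      by rewrite -(ler_pM2r ba0) (le_trans rw)//; lra.
    have gw := le_trans (dist_ext_le g (g_ delta) (Xc _ w01)) gd.
    have fg2 : gamma * (2 * f delta) <= e / 2.
      rewrite ler_pdivlMr ?mulr_gt0// in fg; last by lra.
      nra.
    have -> : F w - G w = (F w - ext (g_ delta) (a + w *: (b - a)))
        - (ext g (a + w *: (b - a)) - ext (g_ delta) (a + w *: (b - a))).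
      by rewrite /G; ring.
    by rewrite (le_trans (ler_normB _ _))//; lra.
  apply: Fle.
  - by rewrite divr_ge0// ltW.
  - by rewrite ler_pM2r ?invr_gt0//; lra.
  - by rewrite ler_pM2r ?invr_gt0//; lra.
  - by rewrite ler_pdivrMr// /T; lra.
move: main; rewrite /G !cE subrr scale0r addr0.
have -> : x + (1 + s1 - s1) *: (y - x) = y by rewrite addrK scale1r addrC subrK.
have -> : x + (s1 + kk - s1) *: (y - x) = conv k (y : convex_lmodType _) x.
  apply/rowP => i; rewrite !mxE/= /unstable.onem /kk; ring.
move=> /(ler_wpM2l (ltW T0)); rewrite mulrDr.
have TE (w w' c : R) : T * ((w / T - w' / T) * c) = (w - w') * c.
  by field; exact: lt0r_neq0.
rewrite !TE [X in _ -> _ <= X]convRE /unstable.onem -/kk; lra.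
Unshelve. all: by end_near. Qed.

End superior_limit_constrained.

(** * Left inclusion: interpolants of a strictly convex perturbation *)

Section interpolated_approximation.
Context {R : realType} {d : nat} {X : set 'rV[R]_d}.
Local Notation CX := (bcts R (set_type X)).
Variables (C_I : R) (E : R -> set CX) (I : R -> {linear CX -> CX}).
Variables (U : R -> set 'rV[R]_d) (f : R -> R) (gamma : R).
Hypothesis hX : bounded_convex_domain X.
Hypothesis C_I_ge1 : 1 <= C_I.
Hypothesis hI : forall delta : R, 0 < delta ->
  interpolation_operator C_I delta (E delta) (I delta).
Hypothesis hU : forall eps : R, 0 < eps -> boundary_net X eps (U eps).
Hypothesis f_gt0 : forall delta : R, 0 < delta -> 0 < f delta.
Hypothesis f_rate : delta / f delta ^+ 2 @[delta --> 0^'+] --> (0 : R).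
Hypothesis gamma_gt0 : 0 < gamma.

Lemma constrained_interpolation_cvg (g : CX) :
  convex_continuous g -> B_Lip (X := X) (gamma / C_I) g ->
  superior_limit (fun delta => constrained (discretized_convexity (X := X)
    (f delta) (U (f delta))) `&` E delta `&` B_Lip (X := X) gamma) g.
Proof.
have [bX cX clX _] := hX.
move=> cg; set k := gamma / C_I => Lg.
have C0 : 0 < C_I := lt_le_trans ltr01 C_I_ge1.
have k0 : 0 < k by exact: divr_gt0.
have [D D0 bD] := bounded_enorm bX.
have [q qE] := squared_enorm_bcts bX.
have Lq := lipschitz_squared_enorm qE (ltW D0) bD.
(* The interpolation error is at most [delta * k], so the coefficient [s] of [q] must satisfy
   [2 * (delta * k) <= s * f delta ^+ 2]; equality gives [s = 2 * k * rho delta]. *)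
pose rho delta := delta / f delta ^+ 2.
have rho_ge0 delta : 0 < delta -> 0 <= rho delta.
  by move=> d0; rewrite divr_ge0 ?sqr_ge0// ltW.
(* The factor 1 - 4 D rho makes room for the Lipschitz constant 2 D of q. *)
pose h delta : CX := (1 - 4 * D * rho delta) *: g + (2 * k * rho delta) *: q.
have Lh delta : 0 < delta -> 4 * D * rho delta <= 1 -> B_Lip (X := X) k (h delta).
  move=> d0 small; have r0 := rho_ge0 _ d0.
  have := lipschitzD (lipschitzZ (1 - 4 * D * rho delta) Lg)
                     (lipschitzZ (2 * k * rho delta) Lq).
  have s0 : 0 <= 2 * k * rho delta by rewrite mulr_ge0// mulr_ge0// ltW.
  rewrite (ger0_norm s0) ger0_norm ?subr_ge0// -/(h delta).
  by congr B_Lip; ring.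
have hI_dist : forall delta, 0 < delta -> 4 * D * rho delta <= 1 ->
    `|h delta - I delta (h delta)| <= delta * k.
  move=> delta d0 small; rewrite -lee_fin EFinM.
  apply: (le_trans (interp_L2 (hI d0) _)).
  rewrite lee_pmul2l//; exact: lipschitz_Lip_le (Lh _ d0 small).
(* A member is required for every positive [delta]. Where the coefficient of [g] would be negative,
   the zero function is a valid choice; for small [delta] this case does not occur. *)
exists (fun delta => if 4 * D * rho delta <= 1 then I delta (h delta) else 0).
split; last first.
  apply/cvgrPdist_le => e e0.
  (* [K * rho delta] bounds the perturbation [g - h delta]. It and the interpolation error
     [delta * k] each get [e / 2]; [K + 1] avoids a zero denominator. *)
  pose K := 4 * D * `|g| + 2 * k * `|q|.
  have k20 : 0 < 2 * k by exact: mulr_gt0.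
  have K0 : 0 <= K by apply: addr_ge0; rewrite mulr_ge0// mulr_ge0// ltW.
  have K20 : 0 < 2 * (K + 1) by rewrite mulr_gt0// ltr_wpDl.
  have rho_small c : 0 < c -> \forall delta \near 0^'+, rho delta <= c.
    move=> c0; near=> delta; apply: (le_trans (ler_norm _)).
    by rewrite -normrN -sub0r; near: delta; exact: cvgr_dist_le.
  near=> delta.
  have d0 : 0 < delta by near: delta; exact: nbhs_right_gt.
  have r0 := rho_ge0 _ d0.
  have r1 : rho delta <= (4 * D)^-1.
    by near: delta; apply: rho_small; rewrite invr_gt0 mulr_gt0.
  have r2 : rho delta <= e / (2 * (K + 1)).
    by near: delta; apply: rho_small; exact: divr_gt0.
  have d2 : delta <= e / (2 * k).
    by near: delta; apply: nbhs_right_le; exact: divr_gt0.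
  have small : 4 * D * rho delta <= 1.
    by rewrite mulrC -ler_pdivlMr ?mulr_gt0// mul1r.
  rewrite small.
  have gh : `|g - h delta| <= K * rho delta.
    have -> : g - h delta = (4 * D * rho delta) *: g - (2 * k * rho delta) *: q.
      by rewrite /h scalerBl scale1r opprD opprB addrA addrCA subrr addr0.
    rewrite (le_trans (ler_normB _ _))// (normrZ _ g) (normrZ _ q).
    have s0 : 0 <= 2 * k * rho delta by rewrite mulr_ge0// mulr_ge0// ltW.
    have t0 : 0 <= 4 * D * rho delta by rewrite mulr_ge0// mulr_ge0// ltW.
    by rewrite (ger0_norm s0) (ger0_norm t0) /K; lra.
  rewrite ler_pdivlMr// in r2.
  rewrite ler_pdivlMr// in d2.
  have -> : g - I delta (h delta) = (g - h delta) + (h delta - I delta (h delta)).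
    by rewrite addrA subrK.
  rewrite (le_trans (ler_normD _ _))//.
  have := hI_dist _ d0 small; lra.
move=> delta d0; have hId := hI d0.
case: ifPn => [small|_]; last first.
  split; first split.
  - move=> _ [p [p' [x [y [z [_ _ _ _ ->]]]]]].
    by rewrite /ell !ext0 !mulr0 !subr0.
  - rewrite -(raddf0 (I delta)); exact: (interp_range hId).
  - split; first exact: ltW.
    by move=> x y _ _; rewrite !ext0 subrr normr0 mulr_ge0 ?enorm_ge0// ltW.
have fd0 := f_gt0 d0.
split; first split.
- apply: (@constrained_perturbation _ _ _ (f delta) (U (f delta)) g q _
    (1 - 4 * D * rho delta) (2 * k * rho delta) (delta * k)) => //.
  + by move=> x /(hU fd0).1 [/clX].
  + by rewrite subr_ge0.
  + by rewrite mulr_ge0 ?rho_ge0// mulr_ge0// ltW.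
  + exact: hI_dist.
  + by rewrite -mulrA divfK ?expf_neq0 ?gt_eqF//; lra.
- exact: (interp_range hId).
(* Interpolation multiplies the Lipschitz constant by at most [C_I], which turns [gamma / C_I] into
   [gamma]. *)
- apply: Lip_le_lipschitz; apply: (le_trans (interp_L1 hId _)).
  apply: (@le_trans _ _ (C_I%:E * k%:E)%E).
    by rewrite lee_pmul2l//; exact: lipschitz_Lip_le (Lh _ d0 small).
  by rewrite -EFinM /k mulrC divfK ?gt_eqF.
Unshelve. all: by end_near. Qed.

End interpolated_approximation.

Theorem theorem2p5 (R : realType) (d : nat) (X : set 'rV[R]_d)
    (hX : bounded_convex_domain X)
    (C_I : R) (hC : 1 <= C_I)
    (E : R -> set (bcts R (set_type X))) (I : R -> {linear bcts R (set_type X) -> bcts R (set_type X)})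
    (hI : forall delta : R, 0 < delta ->
       interpolation_operator C_I delta (E delta) (I delta))
    (U : R -> set 'rV[R]_d)
    (hU : forall eps : R, 0 < eps -> boundary_net X eps (U eps))
    (f : R -> R)
    (hf_pos : forall delta : R, 0 < delta -> 0 < f delta)
    (hf_lim : f delta @[delta --> 0^'+] --> (0 : R))
    (hf_rate : delta / f delta ^+ 2 @[delta --> 0^'+] --> (0 : R))
    (gamma : R) (hgamma : 0 < gamma) :
  let M (eps : R) := discretized_convexity (X := X) eps (U eps) in
  let limsup := superior_limit (fun delta : R =>
    constrained (M (f delta)) `&` E delta `&` B_Lip (X := X) gamma) in
  convex_continuous (X := X) `&` B_Lip (X := X) (gamma / C_I) `<=` limsup /\
  limsup `<=` convex_continuous (X := X) `&` B_Lip (X := X) gamma.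
Proof.
split=> [g [cg Lg]|g [g_ [g_in g_cvg]]].
  exact: (constrained_interpolation_cvg hX hC hI hU hf_pos hf_rate hgamma cg Lg).
have cg_ delta (d0 : 0 < delta) := (g_in _ d0).1.1.
have Lg_ delta (d0 : 0 < delta) := (g_in _ d0).2.
split; first exact: (convex_cvg hX hU hf_pos hf_lim cg_ Lg_ g_cvg).
exact: lipschitz_cvg Lg_ g_cvg.
Qed.
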